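(* Let $n\ge1$ and $a\in\mathbb{R}$, and consider the permutation-symmetric $n$-dimensional cost function $$J_{n,a}(x_1,\dots,x_n)=\tfrac12\left(\Bigl(\prod_{i=1}^nx_i\Bigr)^{a}+\Bigl(\prod_{i=1}^nx_i\Bigr)^{-a}\right)-1,\qquad x_i>0.$$ Suppose that it reduces to the one-dimensional cost when all variables are equal, i.e. $J_{n,a}(x,\dots,x)=\tfrac12(x+x^{-1})-1$ for all $x>0$. Then $a=\pm\frac1n$, and both choices give the same cost function, namely $$J(x_1,\dots,x_n)=\tfrac12\left(\Bigl(\prod_{i=1}^nx_i\Bigr)^{1/n}+\Bigl(\prod_{i=1}^nx_i\Bigr)^{-1/n}\right)-1 .$$ *)

(* Defs.v *)
From mathcomp Require Import all_boot all_order all_algebra.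
From mathcomp Require Import reals exp.

Set Implicit Arguments.
Unset Strict Implicit.
Unset Printing Implicit Defensive.

Import Order.TTheory GRing.Theory Num.Theory.

Local Open Scope ring_scope.

(* The costs are only meaningful at positive arguments; they are total here,
   and positivity is a hypothesis wherever they are used. *)
Definition cost1 (R : realType) (x : R) : R := 2^-1 * (x + x^-1) - 1.

Definition cost (R : realType) (n : nat) (a : R) (x : 'I_n -> R) : R :=
  2^-1 * ((\prod_(i < n) x i) `^ a + (\prod_(i < n) x i) `^ (- a)) - 1.

(* Main.v *)
(* With [u = 2 `^ (n * a)], the diagonal condition at [x = 2] reads
   [u + u^-1 = 2 + 2^-1], hence [u = 2] or [u = 2^-1], and [ln] gives
   [n * a = 1] or [n * a = -1]. *)

Require Import Defs.
From mathcomp Require Import all_boot all_order all_algebra.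
From mathcomp Require Import reals exp.
From mathcomp Require Import ring.

Set Implicit Arguments.
Unset Strict Implicit.
Unset Printing Implicit Defensive.

Import Order.TTheory GRing.Theory Num.Theory.

Local Open Scope ring_scope.

(** Since [t + t^-1] determines [t] up to inversion ([addrV_inj]), the single point [x = 2] fixes
    [n%:R * a] up to sign, by injectivity of [powR 2] ([powRI]). The sign is immaterial: negating
    [a] swaps the two summands ([costN]). *)

(** Multiplying the difference of the two sides by [u] gives [(u - v) * (u - v^-1)]. *)
Lemma addrV_inj (F : fieldType) (u v : F) : u != 0 -> v != 0 ->
  u + u^-1 = v + v^-1 -> u = v \/ u = v^-1.
Proof.
move=> u0 v0 uv.
have /eqP : (u - v) * (u - v^-1) = 0.
  have -> : (u - v) * (u - v^-1) = u * ((u + u^-1) - (v + v^-1)).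
    by field; rewrite u0 v0.
  by rewrite uv subrr mulr0.
by rewrite mulf_eq0 !subr_eq0 => /orP[] /eqP; [left | right].
Qed.

Lemma powRI (R : realType) (b : R) : 1 < b -> injective (powR b).
Proof.
move=> b1 r s /(congr1 (@ln R)); rewrite !ln_powR; apply: mulIf.
by rewrite gt_eqF // ln_gt0.
Qed.

Lemma cost_diag (R : realType) (n : nat) (a x : R) : 0 < x ->
  cost a (fun _ : 'I_n => x) = cost1 (x `^ (n%:R * a)).
Proof.
move=> x0; rewrite /cost /cost1 prodr_const card_ord powRN.
by rewrite -powR_mulrn ?ltW // -powRrM.
Qed.

Lemma costN (R : realType) (n : nat) (a : R) (x : 'I_n -> R) :
  cost (- a) x = cost a x.
Proof. by rewrite /cost opprK [X in _ * X]addrC. Qed.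

Theorem mainTheorem6 (R : realType) (n : nat) (a : R)
    (n_ge1 : (1 <= n)%N)
    (diag : forall x : R, 0 < x -> cost a (fun _ : 'I_n => x) = cost1 x) :
  (a = 1 / n%:R \/ a = - (1 / n%:R)) /\
  (forall x : 'I_n -> R, (forall i, 0 < x i) ->
    let J := 2^-1 * ((\prod_(i < n) x i) `^ (1 / n%:R)
                     + (\prod_(i < n) x i) `^ (- (1 / n%:R))) - 1 in
    cost (1 / n%:R) x = J /\ cost (- (1 / n%:R)) x = J).
Proof.
have n0 : n%:R != 0 :> R by rewrite pnatr_eq0 -lt0n.
(* [J] is [cost (1 / n%:R) x] unfolded, so only the negated exponent needs an argument. *)
split; last by move=> x _ J; rewrite costN.
have two0 : (0 : R) < 2 by rewrite ltr0n.
have two1 : (1 : R) < 2 by rewrite ltr1n.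
(* Cancelling the common [- 1] and the factor [2^-1] leaves an equation of the form
   [u + u^-1 = 2 + 2^-1]. *)
have := diag 2 two0; rewrite cost_diag // => /addIr /mulfI.
rewrite invr_eq0 gt_eqF // => /(_ isT) /addrV_inj.
rewrite !gt_eqF ?powR_gt0 // => /(_ isT isT)[u2 | u2]; [left | right].
  have na : n%:R * a = 1 by apply: (powRI two1); rewrite u2 powRr1 ?ltW.
  by apply: (mulfI n0); rewrite na mul1r divff.
have na : n%:R * a = -1.
  by apply: (powRI two1); rewrite u2 powRN powRr1 ?ltW.
by apply: (mulfI n0); rewrite na mul1r mulrN divff.
Qed.
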